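(* Let $q:\mathbb R^n\times\mathbb R^s\to\mathbb R^{m_1+m_2}$ and $h:\mathbb R^n\times\mathbb R^s\to\mathbb R^k$ be mappings, $A\in\mathbb R^{k\times(m_1+m_2)}$ and $D\in\mathbb R^{(m_1+m_2)\times(m_1+m_2)}$. Assume: - $A$ and $D$ have rational entries; - $D$ is symmetric and positive definite; - $\{y\in\mathbb R^{m_1}\times\mathbb Z^{m_2}\mid Ay\le t\}\neq\emptyset$ for every $t\in\mathbb R^k$; - $q$ and $h$ are continuous; - $\|q(\cdot,\cdot)\|$ and $\|h(\cdot,\cdot)\|$ are limited by exponents $\gamma_q,\gamma_h\in]0,\infty[$, respectively. Define $$f(x,z)=\inf_y\{y^\top Dy+q(x,z)^\top y\mid Ay\le h(x,z),\ y\in\mathbb R^{m_1}\times\mathbb Z^{m_2}\},\qquad (x,z)\in\mathbb R^n\times\mathbb R^s.$$ Then $f$ is finite, lower semicontinuous and limited by the exponent $\max\{2\gamma_q,2\gamma_h\}$; in particular, $f$ is Borel-measurable and limited by an exponent in $]0,\infty[$. Moreover, $f$ is continuous if the set $$\Big\{y_2\in\mathbb Z^{m_2}\ \Big|\ \exists\,y_1\in\mathbb R^{m_1}:\ A\begin{pmatrix} y_1 \\ y_2 \end{pmatrix}\le h(x,z)\Big\}$$ does not depend on $(x,z)$.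
   Context: $\|\cdot\|$ is the Euclidean norm; vector inequalities are componentwise. A mapping $e:\mathbb R^n\times\mathbb R^s\to\mathbb R$ is limited by the exponent $\gamma\in]0,\infty[$ if there is a locally bounded mapping $\eta:\mathbb R^n\to]0,\infty[$ with $|e(x,z)|\le\eta(x)(\|z\|^\gamma+1)$ for all $(x,z)\in\mathbb R^n\times\mathbb R^s$. *)

(* Defs.v *)
From mathcomp Require Export all_boot all_order all_algebra.
From mathcomp Require Export all_classical all_reals all_analysis.
From mathcomp Require Export measurable_realfun.
Export Order.TTheory GRing.Theory Num.Theory.
Export numFieldNormedType.Exports.

Set Implicit Arguments.
Unset Strict Implicit.
Unset Printing Implicit Defensive.

Local Open Scope classical_set_scope.
Local Open Scope ring_scope.

(* The library norm on matrices is the sup norm, hence this definition. *)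
Definition enorm (R : realType) (d : nat) (x : 'cV[R]_d) : R :=
  Num.sqrt (\sum_i x i 0 ^+ 2).

Definition cvle (R : realType) (d : nat) (u v : 'cV[R]_d) : Prop :=
  forall i, u i 0 <= v i 0.

Definition rational_mx (R : realType) (d e : nat) (M : 'M[R]_(d, e)) : Prop :=
  forall i j, exists r : rat, M i j = ratr r.

Definition posdef (R : realType) (d : nat) (M : 'M[R]_d) : Prop :=
  forall y : 'cV[R]_d, y != 0 -> 0 < (y^T *m M *m y) 0 0.

Definition limited_by (R : realType) (n s : nat)
    (e : 'cV[R]_n * 'cV[R]_s -> R) (g : R) : Prop :=
  0 < g /\
  exists eta : 'cV[R]_n -> R,
    [/\ forall x, 0 < eta x,
        [locally [bounded eta x | x in [set: 'cV[R]_n]]] &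
        forall x z, `|e (x, z)| <= eta x * (enorm z `^ g + 1)].

(* Z^m2 is regarded as the set of integral vectors of R^m2, and the vector
   with blocks y1 and y2 is col_mx y1 y2. *)
Definition integral_vectors (R : realType) (d : nat) : set 'cV[R]_d :=
  [set y | y \is a mxOver Num.int].

Definition mixed_integer (R : realType) (m1 m2 : nat) : set 'cV[R]_(m1 + m2) :=
  [set y | integral_vectors (dsubmx y)].

Definition feasible (R : realType) (m1 m2 k : nat)
    (A : 'M[R]_(k, m1 + m2)) (t : 'cV[R]_k) : set 'cV[R]_(m1 + m2) :=
  [set y | mixed_integer y /\ cvle (A *m y) t].

(* The infimum is taken in the extended reals, so that finiteness is a
   statement about it rather than a convention. *)
Definition miqp_value (R : realType) (m1 m2 k : nat)
    (A : 'M[R]_(k, m1 + m2)) (D : 'M[R]_(m1 + m2))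
    (c : 'cV[R]_(m1 + m2)) (t : 'cV[R]_k) : \bar R :=
  ereal_inf [set ((y^T *m D *m y) 0 0 + (c^T *m y) 0 0)%:E | y in feasible A t].

Definition feasible_integral_parts (R : realType) (m1 m2 k : nat)
    (A : 'M[R]_(k, m1 + m2)) (t : 'cV[R]_k) : set 'cV[R]_m2 :=
  [set y2 | integral_vectors y2 /\
     exists y1 : 'cV[R]_m1, cvle (A *m col_mx y1 y2) t].

Definition borel_measurable (R : realType) (n s : nat)
    (f : 'cV[R]_n * 'cV[R]_s -> \bar R) : Prop :=
  let B := g_sigma_algebraType (@open ('cV[R]_n * 'cV[R]_s)%type) in
  measurable_fun [set: B] (f : B -> \bar R).

(* Main.v *)
Require Import Defs.
From mathcomp Require Import ring lra.

(* By coercivity of D the objective is bounded below by -C |q|^2, and scaling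
   one mixed-integer point y0 with A y0 <= -1 by an integer N >= |h| gives a
   feasible point of norm O(|h| + 1), which bounds the value above; this yields
   finiteness and the growth exponent. Coercivity also confines near-optimal
   points to a fixed compact box for parameters close to a given one, and the
   feasibility relation is closed, whence lower semicontinuity. If the set of
   integral parts is constant, the integral part of a near-optimal point remains
   available for all parameters, and the continuous part can be moved by
   O(|h(p') - h(p)|) by Hoffman's Lipschitz bound for polyhedra (proved by
   Fourier-Motzkin elimination), whence upper semicontinuity. *)

Set Implicit Arguments.
Unset Strict Implicit.
Unset Printing Implicit Defensive.

Local Open Scope classical_set_scope.
Local Open Scope ring_scope.

(** * Fourier-Motzkin elimination and Hoffman's bound for polyhedra *)

Lemma ler_norm_sum_mul (R : realDomainType) (m : nat) (a x : 'I_m -> R) (e : R) :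
  (forall j, `|x j| <= e) ->
  `|\sum_j a j * x j| <= (\sum_j `|a j|) * e.
Proof.
move=> xe; apply: le_trans (ler_norm_sum _ _ _) _; rewrite mulr_suml.
by apply: ler_sum => j _; rewrite normrM ler_wpM2l.
Qed.

(* Fourier-Motzkin elimination of a variable whose coefficient in row [i] is
   [c i]. The rows of the projected system are indexed by all pairs of rows: a
   pair of opposite signs gives the usual combination, a row with [c i = 0] is
   kept as the pair [(i, i)], and every other pair gives the void row
   [0 <= 0]. *)
Section fourier_motzkin.
Variables (R : realFieldType) (I : finType) (c : I -> R).

Definition fm_left (p : I * I) : R :=
  if (0 < c p.1) && (c p.2 < 0) then - c p.2
  else ((p.1 == p.2) && (c p.1 == 0))%:R.

Definition fm_right (p : I * I) : R :=
  if (0 < c p.1) && (c p.2 < 0) then c p.1 else 0.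

Lemma fm_left_ge0 p : 0 <= fm_left p.
Proof.
by rewrite /fm_left; case: ifP => [/andP[_ /ltW]|_]; rewrite ?oppr_ge0 ?ler0n.
Qed.

Lemma fm_right_ge0 p : 0 <= fm_right p.
Proof. by rewrite /fm_right; case: ifP => [/andP[/ltW]|_]. Qed.

Definition fm_comb (u : I -> R) (p : I * I) : R :=
  fm_left p * u p.1 + fm_right p * u p.2.

(** The multipliers are chosen for exactly this: in every combined row the eliminated variable
    cancels. *)
Lemma fm_comb_eq0 p : fm_comb c p = 0.
Proof.
rewrite /fm_comb /fm_left /fm_right; case: ifP => [_|_]; first by ring.
rewrite mul0r addr0; case: (altP (p.1 =P p.2)) => _ /=; last by rewrite mul0r.
by case: eqP => [->|_]; rewrite ?mulr0 ?mul0r.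
Qed.

Lemma fm_comb_le u v p : (forall i, u i <= v i) -> fm_comb u p <= fm_comb v p.
Proof.
by move=> uv; rewrite lerD// ler_wpM2l ?uv ?fm_left_ge0 ?fm_right_ge0.
Qed.

Lemma fm_comb_addl u v (t : R) p :
  fm_comb (fun i => v i * t + u i) p = fm_comb v p * t + fm_comb u p.
Proof. by rewrite /fm_comb; ring. Qed.

Lemma fm_comb_dist u v (d : R) p : (forall i, `|u i - v i| <= d) ->
  `|fm_comb u p - fm_comb v p| <= (fm_left p + fm_right p) * d.
Proof.
move=> uv; rewrite /fm_comb opprD addrACA -!mulrBr.
apply: le_trans (ler_normD _ _) _; rewrite mulrDl !normrM.
by rewrite lerD// ger0_norm ?fm_left_ge0 ?fm_right_ge0// ler_wpM2l
  ?fm_left_ge0 ?fm_right_ge0.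
Qed.

Lemma fm_comb_sum (m : nat) (r : I -> 'I_m -> R) (x : 'I_m -> R) p :
  \sum_j fm_comb (r^~ j) p * x j = fm_comb (fun i => \sum_j r i j * x j) p.
Proof.
rewrite /fm_comb !mulr_sumr -big_split; apply: eq_bigr => j _ /=.
by ring.
Qed.

(** Back-substitution with distance control. Each row with [c i != 0] bounds [t] from one side; the
    projected system puts every lower bound below every upper one, and no bound is violated by [y0]
    by more than [e]. *)
Lemma fm_solvable (u b : I -> R) (y0 e : R) : 0 <= e ->
  (forall p, fm_comb u p <= fm_comb b p) ->
  (forall i, 0 < c i -> y0 <= (b i - u i) / c i + e) ->
  (forall i, c i < 0 -> (b i - u i) / c i <= y0 + e) ->
  exists2 t, (forall i, c i * t + u i <= b i) & `|t - y0| <= e.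
Proof.
move=> e0 ub up lo.
(* The smallest value that meets all lower bounds and is at least [y0 - e]; the default also covers
   the absence of lower bounds. *)
pose t := \big[Num.max/y0 - e]_(k | c k < 0) ((b k - u k) / c k).
exists t; last first.
  rewrite ler_distl; apply/andP; split; first exact: bigmax_ge_id.
  apply/bigmax_leP; split=> //; lra.
move=> i; case: (ltgtP (c i) 0) => ci.
- have : (b i - u i) / c i <= t by apply: le_bigmax_cond.
  rewrite ler_ndivrMr// mulrC; lra.
- have : t <= (b i - u i) / c i.
    apply/bigmax_leP; split; first by have := up _ ci; lra.
    (* The projected row of the pair [(i, k)] says that the lower bound from [k] is at most the
       upper bound from [i]. *)
    move=> k ck; have := ub (i, k).
    rewrite /fm_comb /fm_left /fm_right /= ci ck /= => ubik.
    rewrite ler_ndivrMr// mulrAC ler_pdivrMr//; nra.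
  rewrite ler_pdivlMr// mulrC; lra.
- have := ub (i, i); rewrite /fm_comb /fm_left /fm_right /= ci ltxx eqxx eqxx /=.
  by rewrite !mul1r !mul0r !addr0 add0r.
Qed.

End fourier_motzkin.

(** Induction on the number of variables: the projected system moves the remaining coordinates, then
    the eliminated one follows. The constant is built from [a] alone, hence is uniform in the
    right-hand sides and in [y]. *)
Lemma polyhedron_lipschitz (R : realFieldType) (m : nat) (I : finType)
    (a : I -> 'I_m -> R) :
  exists2 L, 0 <= L & forall (b b' : I -> R) (d : R) (y : 'I_m -> R),
    0 <= d -> (forall i, `|b' i - b i| <= d) ->
    (forall i, \sum_j a i j * y j <= b i) ->
    (exists x, forall i, \sum_j a i j * x j <= b' i) ->
    exists2 x, (forall i, \sum_j a i j * x j <= b' i) &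
      forall j, `|x j - y j| <= L * d.
Proof.
elim: m I a => [|m IH] I a.
  by exists 0 => // b b' d y _ _ _ [x xb]; exists x => // -[].
pose c i := a i ord0; pose r i j := a i (lift ord0 j).
have [L L0 HL] := IH _ (fun p j => fm_comb c (r^~ j) p).
(* Combining rows enlarges a perturbation [d] of the right-hand side to at most [M * d]. *)
pose M := \sum_p (fm_left c p + fm_right c p).
have M0 : 0 <= M.
  by apply: sumr_ge0 => p _; rewrite addr_ge0 ?fm_left_ge0 ?fm_right_ge0.
pose rho i := \sum_j `|r i j|.
have rho0 i : 0 <= rho i by apply: sumr_ge0.
(* In row [i] the right-hand side moves by [d] and the other coordinates contribute at most
   [rho i * (L * M) * d]; division by [|c i|] turns this into a shift of the first coordinate. The
   sum dominates every row; terms with [c i = 0] vanish because the inverse of 0 is 0. *)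
pose N := \sum_i (1 + rho i * (L * M)) / `|c i|.
have LM0 : 0 <= L * M by rewrite mulr_ge0.
have N0 : 0 <= N.
  by apply: sumr_ge0 => i _; rewrite divr_ge0 ?addr_ge0 ?mulr_ge0.
exists (N + L * M); first by rewrite addr_ge0.
move=> b b' d y d0 bb' yb [z zb'].
have rowE x i : \sum_j a i j * x j =
    c i * x ord0 + \sum_j r i j * x (lift ord0 j) by rewrite big_ord_recl.
have proj x (bx : I -> R) : (forall i, \sum_j a i j * x j <= bx i) -> forall p,
    \sum_j fm_comb c (r^~ j) p * x (lift ord0 j) <= fm_comb c bx p.
  move=> xbx p; rewrite (fm_comb_sum c r (fun j => x (lift ord0 j))).
  apply: le_trans (fm_comb_le c p xbx).
  under [X in _ <= fm_comb _ X _]funext do rewrite rowE.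
  by rewrite fm_comb_addl fm_comb_eq0 mul0r add0r.
have [||||x xb' xy] := HL (fm_comb c b) (fm_comb c b') (M * d)
    (fun j => y (lift ord0 j)).
- by rewrite mulr_ge0.
- move=> p; apply: le_trans (fm_comb_dist c p bb') _; apply: ler_wpM2r => //.
  rewrite /M (bigD1 p)//= lerDl; apply: sumr_ge0 => q _.
  by rewrite addr_ge0 ?fm_left_ge0 ?fm_right_ge0.
- exact: proj.
- by exists (fun j => z (lift ord0 j)); exact: proj.
pose u i := \sum_j r i j * x j.
have uy i : `|u i - \sum_j r i j * y (lift ord0 j)| <= rho i * (L * M) * d.
  rewrite /u -sumrB; under eq_bigr do rewrite -mulrBr.
  by rewrite -mulrA; apply: ler_norm_sum_mul => j; rewrite -mulrA.
have ciN i : c i != 0 -> (1 + rho i * (L * M)) * d <= N * d * `|c i|.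
  move=> ci; rewrite mulrAC ler_wpM2r// -ler_pdivrMr ?normr_gt0//.
  rewrite /N (bigD1 i)//= lerDl; apply: sumr_ge0 => k _.
  by rewrite divr_ge0 ?addr_ge0 ?mulr_ge0.
have key i : c i != 0 -> c i * y ord0 + u i <= b' i + N * d * `|c i|.
  move=> ci; have := ciN i ci; have := uy i; have := yb i; have := bb' i.
  by rewrite rowE !ler_distl => /andP[? ?] ? /andP[? ?]; lra.
have [||||t tb' ty] := @fm_solvable R I c u b' (y ord0) (N * d).
- by rewrite mulr_ge0.
- by move=> p; rewrite -fm_comb_sum.
- move=> i ci; have := key i; rewrite gt_eqF// gtr0_norm// => /(_ isT) H.
  rewrite -lerBlDr ler_pdivlMr//; lra.
- move=> i ci; have := key i; rewrite lt_eqF// ltr0_norm// => /(_ isT) H.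
  rewrite ler_ndivrMr//; lra.
(* Coordinate 0 is [t]; the others come from the induction hypothesis. *)
exists (fun j => if unlift ord0 j is Some k then x k else t).
  move=> i; rewrite rowE unlift_none; under eq_bigr do rewrite liftK.
  exact: tb'.
move=> j; case: unliftP => [k ->|->]; rewrite mulrDl.
  by apply: le_trans (xy k) _; rewrite mulrA lerDr mulr_ge0.
by apply: le_trans ty _; rewrite lerDl mulr_ge0.
Qed.

(** * Matrix norms and limits, compactness of boxes, coercivity *)

Lemma mx_entry_le_norm (R : realType) (m n : nat) (x : 'M[R]_(m, n)) i j :
  `|x i j| <= `|x|.
Proof.
by rewrite [leRHS]/Num.norm/= mx_normrE; apply: (le_bigmax _ _ (i, j)).
Qed.

Lemma mx_norm_le (R : realType) (m n : nat) (x : 'M[R]_(m, n)) (e : R) :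
  0 <= e -> (forall i j, `|x i j| <= e) -> `|x| <= e.
Proof.
by move=> e0 xe; rewrite [leLHS]/Num.norm/= mx_normrE; apply/bigmax_leP; split.
Qed.

Lemma enorm_ge0 (R : realType) (d : nat) (x : 'cV[R]_d) : 0 <= enorm x.
Proof. exact: sqrtr_ge0. Qed.

Lemma norm_le_enorm (R : realType) (d : nat) (x : 'cV[R]_d) : `|x| <= enorm x.
Proof.
apply: mx_norm_le; first exact: enorm_ge0.
move=> i j; rewrite (ord1 j) -sqrtr_sqr ler_sqrt ?sumr_ge0// => [|k _].
  by rewrite (bigD1 i)//= lerDl sumr_ge0// => k _; rewrite sqr_ge0.
by rewrite sqr_ge0.
Qed.

Lemma cvg_sum_fun (R : realType) (T : Type) (F : set_system T) (I : finType)
    (f : I -> T -> R) (l : I -> R) : Filter F ->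
  (forall i, f i t @[t --> F] --> l i) ->
  \sum_i f i t @[t --> F] --> \sum_i l i.
Proof.
move=> FF fl.
rewrite (_ : (fun t => \sum_i f i t) = \sum_i f i); last first.
  by apply/funext => t; rewrite fct_sumE.
elim/big_ind2 : _ => // [|g a h b ga hb]; first exact: cvg_cst.
exact: cvgD ga hb.
Qed.

Section matrix_limits.
Variables (R : realType) (T : Type) (F : set_system T).
Context {FF : Filter F}.

Lemma cvg_mx_entries (m n : nat) (f : T -> 'M[R]_(m, n)) (A : 'M[R]_(m, n)) :
  (forall i j, f t i j @[t --> F] --> A i j) -> f t @[t --> F] --> A.
Proof.
move=> fA U [P PA PU].
have : \near F, forall ij : 'I_m * 'I_n, P ij.1 ij.2 (f F ij.1 ij.2).
  by apply: filter_forall => -[i j] /=; exact: fA (PA i j).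
by apply: filterS => t Pt; apply: PU => i j; exact: (Pt (i, j)).
Qed.

Lemma cvg_mx_entry (m n : nat) (f : T -> 'M[R]_(m, n)) (A : 'M[R]_(m, n)) i j :
  f t @[t --> F] --> A -> f t i j @[t --> F] --> A i j.
Proof.
move=> fA; apply: (@cvg_comp _ _ _ f (fun M : 'M[R]_(m, n) => M i j)) fA _.
exact: coord_continuous.
Qed.

Lemma cvg_trmx (m n : nat) (f : T -> 'M[R]_(m, n)) (A : 'M[R]_(m, n)) :
  f t @[t --> F] --> A -> (f t)^T @[t --> F] --> A^T.
Proof.
move=> fA; apply: cvg_mx_entries => i j; rewrite mxE.
by under eq_cvg do rewrite mxE; exact: cvg_mx_entry.
Qed.

Lemma cvg_mulmx (m n p : nat) (f : T -> 'M[R]_(m, n)) (g : T -> 'M[R]_(n, p))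
    (A : 'M[R]_(m, n)) (B : 'M[R]_(n, p)) :
  f t @[t --> F] --> A -> g t @[t --> F] --> B ->
  f t *m g t @[t --> F] --> A *m B.
Proof.
move=> fA gB; apply: cvg_mx_entries => i j; rewrite mxE.
under eq_cvg do rewrite mxE.
by apply: cvg_sum_fun => k; apply: cvgM; exact: cvg_mx_entry.
Qed.

Lemma cvg_quadratic_form (d : nat) (D : 'M[R]_d) (f : T -> 'cV[R]_d)
    (y : 'cV[R]_d) : f t @[t --> F] --> y ->
  ((f t)^T *m D *m f t) 0 0 @[t --> F] --> (y^T *m D *m y) 0 0.
Proof.
move=> fy; apply: cvg_mx_entry; apply: (cvg_mulmx _ fy).
apply: (@cvg_mulmx _ _ _ (fun t => (f t)^T) (fun=> D)); last exact: cvg_cst.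
exact: cvg_trmx.
Qed.

Lemma cvg_quadratic_function (d : nat) (D : 'M[R]_d) (f g : T -> 'cV[R]_d)
    (c y : 'cV[R]_d) :
  g t @[t --> F] --> c -> f t @[t --> F] --> y ->
  ((f t)^T *m D *m f t) 0 0 + ((g t)^T *m f t) 0 0 @[t --> F] -->
  (y^T *m D *m y) 0 0 + (c^T *m y) 0 0.
Proof.
move=> gc fy; apply: cvgD; first exact: cvg_quadratic_form.
by apply: cvg_mx_entry; apply: (cvg_mulmx _ fy); exact: cvg_trmx.
Qed.

End matrix_limits.

Lemma closed_norm_preimage (R : realType) (m n : nat) (B : set R) :
  closed B -> closed ((fun y : 'M[R]_(m, n) => `|y|) @^-1` B).
Proof. by apply: preimage_closed => z _; exact: norm_continuous. Qed.

(** Bounded closed sets of row vectors are compact; transposition is continuous and preserves the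
    norm, which carries this over to columns. *)
Lemma cV_box_compact (R : realType) (d : nat) (r : R) :
  compact [set y : 'cV[R]_d | `|y| <= r].
Proof.
have -> : [set y : 'cV[R]_d | `|y| <= r] =
    [set z^T | z in [set z : 'rV[R]_d | `|z| <= r]].
  have trN (m n : nat) (x : 'M[R]_(m, n)) : `|x^T| <= `|x|.
    by apply: mx_norm_le => // i j; rewrite mxE mx_entry_le_norm.
  apply/seteqP; split => [y yr|_ [z zr <-]].
    by exists y^T; rewrite ?trmxK//=; exact: le_trans (trN _ _ _) yr.
  exact: le_trans (trN _ _ _) zr.
apply: continuous_compact.
  apply: continuous_subspaceT => z; exact: (@cvg_trmx R _ (nbhs z) _ _ _ id).
apply: bounded_closed_compact.
  exists r; split=> [|x rx z /= zr]; first exact: num_real.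
  by rewrite (le_trans zr)// ltW.
exact: (closed_norm_preimage (@closed_le _ r)).
Qed.

(** The form is positive on the unit sphere, which is compact, so it has a positive lower bound
    there; homogeneity of degree 2 extends the bound to all [y]. *)
Lemma posdef_coercive (R : realType) (d : nat) (D : 'M[R]_d) : posdef D ->
  exists2 lam, 0 < lam &
    forall y : 'cV[R]_d, lam * `|y| ^+ 2 <= (y^T *m D *m y) 0 0.
Proof.
move=> Dpos; pose Q (y : 'cV[R]_d) := (y^T *m D *m y) 0 0.
have Qc : continuous Q.
  move=> y; have idy : id t @[t --> y] --> y by exact: cvg_id.
  exact: cvg_quadratic_form idy.
pose S := [set y : 'cV[R]_d | `|y| = 1].
have Sc : compact S.
  have Scl : closed S by exact: (closed_norm_preimage (@closed_eq _ 1)).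
  by apply: (subclosed_compact Scl (@cV_box_compact R d 1)) => y /= ->.
have /compact_near_coveringP/near_covering_withinP Snc := Sc.
(* The covering form of compactness turns the local bounds [Q y / 2] into one [e] for the whole
   sphere. *)
have : \forall e \near 0^'+, S `<=` [set y | e < Q y].
  apply: Snc => y Sy.
  have y0 : 0 < Q y by apply: Dpos; rewrite -normr_gt0 Sy.
  have : \forall x \near y & e \near (0:R)^'+, Q y / 2 < Q x /\ e < Q y / 2.
    exists ([set x | Q y / 2 < Q x], [set e | e < Q y / 2]) => //=; split.
      by apply: (cvgr_gt _ (Qc y)); rewrite ltr_pdivrMr// ltr_pMr// ltr1n.
    by apply: nbhs_right_lt; rewrite divr_gt0.
  by apply: filterS => -[x e] /= [? ?] _; lra.
move=> /(filterI (nbhs_right_gt _))/filter_ex[e [/= e0 Se]].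
exists e => // y; have [->|y0] := eqVneq y 0.
  by rewrite normr0 expr0n mulr0 trmx0 mul0mx mul0mx mxE.
have yN : 0 < `|y| by rewrite normr_gt0.
have /Se/= : S (`|y|^-1 *: y).
  by rewrite /S/= normrZ normfV normr_id mulVf// gt_eqF.
have -> : Q (`|y|^-1 *: y) = `|y| ^- 2 * Q y.
  rewrite /Q [(_ *: y)^T]linearZ/= -!scalemxAl -scalemxAr scalerA mxE.
  by rewrite -invfM -expr2.
by rewrite mulrC ltr_pdivlMr ?exprn_gt0// => /ltW.
Qed.

(** The open interval between [floor x] and [floor x + 1] is a neighbourhood of [x] without
    integers. *)
Lemma near_not_int (R : realType) (x : R) : x \isn't a Num.int ->
  \forall y \near x, y \isn't a Num.int.
Proof.
move=> xNint; have fx : (Num.floor x)%:~R < x.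
  by rewrite lt_neqAle -intrEfloor xNint; have /andP[] := floor_itv x.
near=> y; apply/negP => /intrP[z yz].
have : (Num.floor x)%:~R < y by near: y; exact: lt_nbhsr.
have : y < (Num.floor x + 1)%:~R.
  by near: y; apply: lt_nbhsl; exact: floorD1_gt.
by rewrite yz !ltr_int ltzD1 => /le_lt_trans/[apply]; rewrite ltxx.
Unshelve. all: by end_near. Qed.

(** * Bounds for the objective and for the optimal value *)

Section miqp.
Variables (R : realType) (m1 m2 k : nat).
Variables (A : 'M[R]_(k, m1 + m2)) (D : 'M[R]_(m1 + m2)).
Implicit Types (c y : 'cV[R]_(m1 + m2)) (t : 'cV[R]_k).

Definition objective c y : R := (y^T *m D *m y) 0 0 + (c^T *m y) 0 0.

Lemma miqp_value_le c t y : feasible A t y ->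
  (miqp_value A D c t <= (objective c y)%:E)%E.
Proof. by move=> ty; apply: ereal_inf_lbound; exists y. Qed.

Lemma le_miqp_value c t (a : R) :
  (forall y, feasible A t y -> a <= objective c y) ->
  (a%:E <= miqp_value A D c t)%E.
Proof.
by move=> H; apply: le_ereal_inf_tmp => _ [y ty <-]; rewrite lee_fin H.
Qed.

Lemma dot_le c y : `|(c^T *m y) 0 0| <= (m1 + m2)%:R * `|c| * `|y|.
Proof.
rewrite mxE; apply: le_trans (ler_norm_sum _ _ _) _.
apply: (@le_trans _ _ (\sum_(i < m1 + m2) `|c| * `|y|)).
  by apply: ler_sum => i _; rewrite normrM mxE ler_pM// mx_entry_le_norm.
by rewrite sumr_const card_ord -mulrA mulr_natl.
Qed.

Lemma objective_coercive : posdef D -> exists lam C, [/\ 0 < lam, 0 <= C &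
  forall c y, lam * `|y| ^+ 2 - C * `|c| ^+ 2 <= objective c y].
Proof.
move=> /posdef_coercive[lam lam0 Hlam]; pose d : R := (m1 + m2)%:R.
exists (lam / 2), (d ^+ 2 / (2 * lam)); split=> [||c y].
- by rewrite divr_gt0.
- by rewrite divr_ge0 ?sqr_ge0// mulr_ge0// ltW.
have := Hlam y; have := dot_le c y; rewrite -/d ler_norml => /andP[cy _] Dy.
rewrite /objective; set u := `|c| in cy *; set v := `|y| in cy Dy *.
(* Completing the square: half of the quadratic term absorbs the linear term [d * u * v]. *)
have : 0 <= (lam * v - d * u) ^+ 2 / (2 * lam).
  by rewrite divr_ge0 ?sqr_ge0// mulr_ge0// ltW.
rewrite (_ : _ / _ = lam / 2 * v ^+ 2 - d * u * v + d ^+ 2 / (2 * lam) * u ^+ 2).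
  lra.
by field; rewrite gt_eqF.
Qed.

(* A feasible point for the right-hand side [-1] can be scaled by any natural
   number [N >= `|t|] to a feasible point for [t]. *)
Lemma objective_growth : (forall t, feasible A t !=set0) ->
  exists2 C, 0 <= C & forall c t, exists2 y, feasible A t y &
    objective c y <= C * (`|c| ^+ 2 + `|t| ^+ 2 + 1).
Proof.
move=> /(_ (const_mx (- 1)))[y0 [y0int Ay0]].
pose d : R := (m1 + m2)%:R; pose Q := `|(y0^T *m D *m y0) 0 0|.
pose B := d * `|y0|.
have B0 : 0 <= B by rewrite mulr_ge0.
have Q0 : 0 <= Q := normr_ge0 _.
exists (2 * Q + B ^+ 2 + 2) => [|c t].
  by rewrite !addr_ge0 ?mulr_ge0 ?sqr_ge0.
pose N := (Num.truncn `|t|).+1.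
have tN : `|t| <= N%:R by apply/ltW/real_truncnS_gt/num_real.
have Nt : N%:R <= `|t| + 1 :> R by rewrite -natr1 lerD2r truncn_le.
exists (N%:R *: y0).
  split.
    apply/mxOverP => i j; rewrite !mxE rpredM ?natr_int//.
    by have /mxOverP/(_ i j) := y0int; rewrite mxE.
  move=> i; rewrite -scalemxAr mxE.
  have := Ay0 i; rewrite [leRHS]mxE => A1.
  apply: (@le_trans _ _ (- `|t i 0|)); last by rewrite lerNl ler_normr lexx orbT.
  have : `|t i 0| <= N%:R by apply: le_trans tN; exact: mx_entry_le_norm.
  have : 0 <= N%:R :> R by [].
  nra.
have -> : objective c (N%:R *: y0) =
    N%:R ^+ 2 * (y0^T *m D *m y0) 0 0 + N%:R * (c^T *m y0) 0 0.
  rewrite /objective [(_ *: y0)^T]linearZ/= -!scalemxAl -!scalemxAr scalerA.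
  by rewrite !mxE expr2.
have := dot_le c y0; rewrite -/d ler_norml => /andP[_ cy0].
have Dy0 : (y0^T *m D *m y0) 0 0 <= Q by exact: ler_norm.
have N0 : 0 <= N%:R :> R by [].
have H1 : N%:R ^+ 2 * (y0^T *m D *m y0) 0 0 <= N%:R ^+ 2 * Q.
  by rewrite ler_wpM2l// sqr_ge0.
have H2 : N%:R * (c^T *m y0) 0 0 <= N%:R * (B * `|c|).
  by rewrite ler_wpM2l// /B mulrAC.
have H3 : N%:R ^+ 2 <= 2 * (`|t| ^+ 2 + 1).
  apply: (@le_trans _ _ ((`|t| + 1) ^+ 2)).
    by rewrite ler_sqr ?nnegrE ?addr_ge0.
  by have := sqr_ge0 (`|t| - 1); lra.
(* The mixed term is split by the inequality between products and squares, so that only [N ^ 2] and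
   [|c| ^ 2] remain. *)
have H4 : N%:R * (B * `|c|) <= N%:R ^+ 2 + B ^+ 2 * `|c| ^+ 2.
  rewrite -exprMn; have := sqr_ge0 (N%:R - B * `|c|).
  by have := sqr_ge0 (N%:R + B * `|c|); lra.
have H5 : N%:R ^+ 2 * (Q + 1) <= 2 * (`|t| ^+ 2 + 1) * (Q + 1).
  by rewrite ler_wpM2r// addr_ge0.
have := sqr_ge0 `|c|; have := sqr_ge0 `|t|; have := sqr_ge0 B.
move: H1 H2 H4 H5; set N2 := N%:R ^+ 2; set T2 := `|t| ^+ 2; set C2 := `|c| ^+ 2.
set B2 := B ^+ 2 => H1 H2 H4 H5 B20 T20 C20.
have : 0 <= Q * C2 by rewrite mulr_ge0.
have : 0 <= B2 * T2 by rewrite mulr_ge0.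
lra.
Qed.

Lemma miqp_value_bound : posdef D -> (forall t, feasible A t !=set0) ->
  exists2 C, 0 <= C & forall c t, miqp_value A D c t \is a fin_num /\
    `|fine (miqp_value A D c t)| <= C * (`|c| ^+ 2 + `|t| ^+ 2 + 1).
Proof.
move=> /objective_coercive[lam [C1 [lam0 C10 lo]]] /objective_growth[C2 C20 up].
exists (C1 + C2) => [|c t]; first by rewrite addr_ge0.
have [y ty yC] := up c t.
have vle : (miqp_value A D c t <= (C2 * (`|c| ^+ 2 + `|t| ^+ 2 + 1))%:E)%E.
  by apply: le_trans (miqp_value_le _ ty) _; rewrite lee_fin.
have vge : ((- (C1 * `|c| ^+ 2))%:E <= miqp_value A D c t)%E.
  apply: le_miqp_value => z _; apply: le_trans (lo c z).
  by rewrite lerDr mulr_ge0 ?sqr_ge0// ltW.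
have vfin : miqp_value A D c t \is a fin_num.
  by rewrite fin_numElt (lt_le_trans (ltNyr _) vge) (le_lt_trans vle (ltry _)).
split=> //; move: vle vge; rewrite -(fineK vfin) !lee_fin /= => vle vge.
have c20 : 0 <= `|c| ^+ 2 by exact: sqr_ge0.
have t20 : 0 <= `|t| ^+ 2 by exact: sqr_ge0.
have := mulr_ge0 C10 c20; have := mulr_ge0 C20 c20.
have := mulr_ge0 C10 t20; have := mulr_ge0 C20 t20.
by move=> *; rewrite ler_norml; apply/andP; split; lra.
Qed.

(** * Semicontinuity of the optimal value in [c] and [t] *)

Lemma near_infeasible t y : ~ feasible A t y ->
  \forall p \near (y, t), ~ feasible A p.2 p.1.
Proof.
have fst_cvg : p.1 @[p --> (y, t)] --> y by exact: cvg_fst.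
have snd_cvg : p.2 @[p --> (y, t)] --> t by exact: cvg_snd.
move=> /not_andP[yNint|/existsNP[i /negP]].
  (* Infeasibility is an open condition: a non-integral entry stays non-integral nearby, and a
     violated inequality, treated second, stays violated. *)
  have [i [j yij]] : exists i j, dsubmx y i j \isn't a Num.int.
    apply: contrapT => H; apply: yNint; apply/mxOverP => i j.
    by apply: contrapT => /negP ij; apply: H; exists i, j.
  rewrite mxE in yij; have entry_cvg :
      (p.1 : 'cV[R]__) (rshift m1 i) j @[p --> (y, t)] --> y (rshift m1 i) j.
    exact: cvg_mx_entry.
  have near_pNint : \forall p \near (y, t),
      (p.1 : 'cV[R]__) (rshift m1 i) j \isn't a Num.int.
    exact: entry_cvg (near_not_int yij).
  apply: filterS near_pNint => p /negP + [/mxOverP/(_ i j)].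
  by rewrite mxE.
rewrite -ltNge -subr_gt0 => tAy.
have gap : (A *m p.1) i 0 - (p.2 : 'cV[R]__) i 0 @[p --> (y, t)] -->
    (A *m y) i 0 - t i 0.
  apply: cvgB; apply: cvg_mx_entry => //.
  by apply: cvg_mulmx fst_cvg; exact: cvg_cst.
have gap_gt : \forall p \near (y, t), 0 < (A *m p.1) i 0 - (p.2 : 'cV[R]__) i 0.
  exact: cvgr_gt gap _ tAy.
apply: filterS gap_gt => p /= + [_ /(_ i)].
by rewrite subr_gt0 ltNge => /negP.
Qed.

Lemma objective_cvg (T : Type) (F : set_system T) {FF : Filter F}
    (c_ y_ : T -> 'cV[R]_(m1 + m2)) c y :
  c_ p @[p --> F] --> c -> y_ p @[p --> F] --> y ->
  objective (c_ p) (y_ p) @[p --> F] --> objective c y.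
Proof. exact: cvg_quadratic_function. Qed.

Lemma miqp_value_lsc c t (a : R) : posdef D -> (forall u, feasible A u !=set0) ->
  (a%:E < miqp_value A D c t)%E ->
  \forall p \near (c, t), (a%:E < miqp_value A D p.1 p.2)%E.
Proof.
move=> Dpos feas; have [lam [C [lam0 C0 coer]]] := objective_coercive Dpos.
have [B B0 vB] := miqp_value_bound Dpos feas; have [vfin _] := vB c t.
rewrite -(fineK vfin) lte_fin; set v := fine _ => av.
(* A bound of the infimum is only weak, so objectives are kept above an intermediate [b] to leave
   the value strictly above [a]. *)
pose b := (a + v) / 2.
have ab : a < b by rewrite /b; lra.
have bv : b < v by rewrite /b; lra.
pose X := `|b| + C * (`|c| + 1) ^+ 2.
have X0 : 0 <= X by rewrite addr_ge0// mulr_ge0// sqr_ge0.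
(* Since [r >= 1], a point with [|y| > r] has [lam * |y| ^ 2 >= lam + X], which outweighs both [b]
   and the loss [C * |c'| ^ 2] for all [c'] with [|c'| <= |c| + 1]. *)
pose r := 1 + X / lam.
have r1 : 1 <= r by rewrite lerDl divr_ge0// ltW.
have far c' y : `|c'| <= `|c| + 1 -> r < `|y| -> b <= objective c' y.
  move=> cc' ry; apply: le_trans (coer c' y).
  have : lam * r <= lam * `|y| ^+ 2.
    rewrite ler_pM2l// expr2; apply: le_trans (ltW ry) _.
    by rewrite ler_peMr//; lra.
  have -> : lam * r = lam + X by rewrite /r; field; rewrite gt_eqF.
  have : C * `|c'| ^+ 2 <= C * (`|c| + 1) ^+ 2.
    by rewrite ler_wpM2l// ler_sqr ?nnegrE// addr_ge0.
  by have := ler_norm b; rewrite /X; lra.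
have /compact_near_coveringP near_box := @cV_box_compact R (m1 + m2) r.
have : \forall p \near (c, t), [set y : 'cV[R]_(m1 + m2) | `|y| <= r] `<=`
    [set y | feasible A p.2 y -> b < objective p.1 y].
  apply: (near_box _ (nbhs (c, t))
    (fun p y => feasible A p.2 y -> b < objective p.1 y) _) => y _.
  (* Around a point feasible for [t] the objective stays above [b] by continuity; around an
     infeasible one all nearby pairs are infeasible. *)
  have [ty|tNy] := pselect (feasible A t y).
    have by_ : b < objective c y.
      by rewrite (lt_le_trans bv)// -lee_fin fineK//; exact: miqp_value_le.
    have fst_cvg : w.1 @[w --> (y, (c, t))] --> y by exact: cvg_fst.
    have snd_cvg : w.2.1 @[w --> (y, (c, t))] --> c.
      exact: (@cvg_comp _ _ _ snd fst _ _ _ cvg_snd cvg_fst).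
    have near_obj : \forall w \near (y, (c, t)), b < objective w.2.1 w.1.
      exact: cvgr_gt (objective_cvg snd_cvg fst_cvg) _ by_.
    by apply: filterS near_obj => w bw _.
  have yt_cvg : (w.1, w.2.2) @[w --> (y, (c, t))] --> (y, t).
    have fst_cvg : w.1 @[w --> (y, (c, t))] --> y by exact: cvg_fst.
    have snd_cvg : w.2.2 @[w --> (y, (c, t))] --> t.
      exact: (@cvg_comp _ _ _ snd snd _ _ _ cvg_snd cvg_snd).
    exact: cvg_pair fst_cvg snd_cvg.
  have near_inf : \forall w \near (y, (c, t)), ~ feasible A w.2.2 w.1.
    exact: yt_cvg (near_infeasible tNy).
  by apply: filterS near_inf => w H /H.
have c_near : \forall p \near (c, t), `|p.1| <= `|c| + 1.
  have fst_cvg : p.1 @[p --> (c, t)] --> c by exact: cvg_fst.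
  have cc' : `|c| < `|c| + 1 by rewrite ltrDl.
  exact: cvgr_le (cvg_norm fst_cvg) _ cc'.
apply: filterS2 c_near => -[c' t'] /= cc' box.
apply: (@lt_le_trans _ _ b%:E); first by rewrite lte_fin.
apply: le_miqp_value => y ty; have [yr|ry] := leP `|y| r; last exact: far.
by apply/ltW/box.
Qed.

(** With the integral part frozen, the continuous part ranges over a polyhedron whose matrix is the
    left block of [A], so one constant serves all integral parts. *)
Lemma feasible_lipschitz : exists2 L, 0 <= L & forall t u y,
  feasible A t y -> feasible_integral_parts A u (dsubmx y) ->
  exists2 x, feasible A u x & `|x - y| <= L * `|u - t|.
Proof.
have [L L0 HL] := polyhedron_lipschitz (fun i j => A i (lshift m2 j)).
exists L => // t u y [yint ty] [_ [x1 ux1]].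
(* The contribution of the integral part goes to the right-hand side and cancels in differences. *)
pose s i := \sum_j A i (rshift m1 j) * dsubmx y j 0.
have rowE x i : (A *m col_mx x (dsubmx y)) i 0 =
    \sum_j A i (lshift m2 j) * x j 0 + s i.
  rewrite mxE big_split_ord /=; congr (_ + _).
    by apply: eq_bigr => j _; rewrite col_mxEu.
  by apply: eq_bigr => j _; rewrite col_mxEd.
have [||||x xu xy] := HL (fun i => t i 0 - s i) (fun i => u i 0 - s i)
    `|u - t| (fun j => usubmx y j 0).
- by [].
- move=> i; rewrite opprB addrA subrK.
  by have := mx_entry_le_norm (u - t) i 0; rewrite !mxE.
- by move=> i; rewrite lerBrDr -rowE vsubmxK.
- by exists (fun j => x1 j 0) => i; rewrite lerBrDr -rowE.
exists (col_mx (\col_j x j) (dsubmx y)).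
  split; first by rewrite /mixed_integer/= col_mxKd.
  move=> i; rewrite rowE -lerBrDr.
  by under eq_bigr do rewrite mxE.
rewrite -[X in _ - X]vsubmxK -[`|_|]/(mx_norm _).
apply: mx_norm_le => [|i j]; first by rewrite mulr_ge0.
rewrite (ord1 j) mxE [X in _ + X]mxE; case: (split_ordP i) => i' ->.
  by rewrite !col_mxEu mxE.
by rewrite !col_mxEd subrr normr0 mulr_ge0.
Qed.

(** A point [y] that beats [a] at [(c, t)] is followed by feasible points [y_ p] that tend to [y],
    and their objectives tend to that of [y]. *)
Lemma miqp_value_usc (T : Type) (F : set_system T) {FF : Filter F}
    (c_ : T -> 'cV[R]_(m1 + m2)) (t_ : T -> 'cV[R]_k) c t (a : R) :
  c_ p @[p --> F] --> c -> t_ p @[p --> F] --> t ->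
  (forall p, feasible_integral_parts A t `<=` feasible_integral_parts A (t_ p)) ->
  (miqp_value A D c t < a%:E)%E ->
  \forall p \near F, (miqp_value A D (c_ p) (t_ p) < a%:E)%E.
Proof.
move=> cc tt parts /ereal_inf_lt[_ [y ty <-]]; rewrite lte_fin => ya.
have [L L0 HL] := feasible_lipschitz.
have /choice[y_ y_P] : forall p, exists x,
    feasible A (t_ p) x /\ `|x - y| <= L * `|t_ p - t|.
  move=> p; have [||x ? ?] := HL t (t_ p) y; [by []| |by exists x].
  apply: parts; have [yint Ay] := ty; split=> //.
  by exists (usubmx y); rewrite vsubmxK.
have yy : y_ p @[p --> F] --> y.
  apply/cvgrPdist_le => e e0.
  (* [L] may be 0, hence the divisor [L + 1]. *)
  have /cvgrPdist_le/(_ (e / (L + 1))) := tt.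
  rewrite divr_gt0 ?ltr_wpDl// => /(_ isT); apply: filterS => p tp.
  rewrite distrC; apply: le_trans (y_P p).2 _; rewrite distrC.
  apply: le_trans (_ : _ <= (L + 1) * (e / (L + 1))) _.
    by apply: ler_pM => //; rewrite lerDl.
  by rewrite mulrC divfK// gt_eqF// ltr_wpDl.
have near_lt : \forall p \near F, objective (c_ p) (y_ p) < a.
  exact: cvgr_lt (objective_cvg cc yy) _ ya.
apply: filterS near_lt => p.
by rewrite -lte_fin; apply: le_lt_trans; apply: miqp_value_le; exact: (y_P p).1.
Qed.

End miqp.

(** * Growth exponents and Borel measurability *)

Lemma sqr_powR_le (R : realType) (z g G : R) : 0 <= z -> 0 < g -> 2 * g <= G ->
  (z `^ g + 1) ^+ 2 <= 4 * (z `^ G + 1).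
Proof.
move=> z0 g0 gG.
have zg0 : 0 <= z `^ g by exact: powR_ge0.
have zG0 : 0 <= z `^ G by exact: powR_ge0.
(* For [z >= 1] the power grows with its exponent; for [z < 1] the left side is at most 1, which the
   added 1 covers. *)
suff : (z `^ g) ^+ 2 <= z `^ G + 1.
  by have := sqr_ge0 (z `^ g - 1); nra.
rewrite -powR_mulrn// -powRrM mulrC.
have [z1|z1] := leP 1 z.
  by apply: le_trans (ler_powR z1 gG) _; rewrite lerDl.
have : z `^ (2 * g) <= 1 `^ (2 * g).
  have g20 : 0 <= 2 * g by rewrite mulr_ge0// ltW.
  by apply: ge0_ler_powR => //; rewrite ?nnegrE// ltW.
rewrite powR1; lra.
Qed.

Lemma limited_by_bound (R : realType) (n s : nat)
    (e u v : 'cV[R]_n * 'cV[R]_s -> R) (gu gv C : R) :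
  0 <= C ->
  (forall p, 0 <= u p) -> (forall p, 0 <= v p) ->
  (forall p, `|e p| <= C * (u p ^+ 2 + v p ^+ 2 + 1)) ->
  limited_by u gu -> limited_by v gv ->
  limited_by e (Num.max (2 * gu) (2 * gv)).
Proof.
move=> C0 u0 v0 eC [gu0 [eu [eu0 eub eul]]] [gv0 [ev [ev0 evb evl]]].
set G := Num.max _ _; have guG : 2 * gu <= G by rewrite le_max lexx.
have gvG : 2 * gv <= G by rewrite le_max lexx orbT.
split; first by apply: lt_le_trans guG; rewrite mulr_gt0.
(* The final [+ 1] keeps the function positive when [C = 0]. *)
exists (fun x => C * (4 * eu x ^+ 2 + 4 * ev x ^+ 2 + 1) + 1); split.
- by move=> x; rewrite ltr_wpDl// mulr_ge0// !addr_ge0// mulr_ge0// sqr_ge0.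
- move=> x _; rewrite withinET.
  have := eub x I; have := evb x I.
  rewrite withinET => /ex_bound[V eV] /ex_bound[U eU].
  apply/ex_bound; exists (C * (4 * U ^+ 2 + 4 * V ^+ 2 + 1) + 1).
  apply: filterS2 eU eV => y /= eyU eyV.
  have yU : eu y <= U := le_trans (ler_norm _) eyU.
  have yV : ev y <= V := le_trans (ler_norm _) eyV.
  have yu := eu0 y; have yv := ev0 y.
  have sU : eu y ^+ 2 <= U ^+ 2 by rewrite ler_sqr ?nnegrE//; lra.
  have sV : ev y ^+ 2 <= V ^+ 2 by rewrite ler_sqr ?nnegrE//; lra.
  rewrite ger0_norm; last first.
    by rewrite addr_ge0// mulr_ge0// !addr_ge0// mulr_ge0// sqr_ge0.
  by rewrite lerD2r ler_wpM2l//; lra.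
move=> x z; apply: le_trans (eC (x, z)) _.
set w := enorm z `^ G; have w0 : 0 <= w by exact: powR_ge0.
have sq (a b g : R) : 0 <= a -> 0 < g -> 2 * g <= G -> 0 < b ->
    `|a| <= b * (enorm z `^ g + 1) -> a ^+ 2 <= 4 * b ^+ 2 * (w + 1).
  move=> a0 g0 gG b0; rewrite ger0_norm// => ab.
  have zg : 0 <= enorm z `^ g + 1 by rewrite addr_ge0// powR_ge0.
  apply: (@le_trans _ _ ((b * (enorm z `^ g + 1)) ^+ 2)).
    by rewrite ler_sqr ?nnegrE// mulr_ge0// ltW.
  rewrite exprMn [4 * _]mulrC -[leRHS]mulrA ler_wpM2l ?sqr_ge0//.
  exact: sqr_powR_le (enorm_ge0 z) g0 gG.
have Hu := sq _ _ _ (u0 (x, z)) gu0 guG (eu0 x) (eul x z).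
have Hv := sq _ _ _ (v0 (x, z)) gv0 gvG (ev0 x) (evl x z).
apply: (@le_trans _ _ (C * (4 * eu x ^+ 2 + 4 * ev x ^+ 2 + 1) * (w + 1))).
  by rewrite -[leRHS]mulrA ler_wpM2l//; lra.
by rewrite ler_wpM2r ?addr_ge0// lerDl.
Qed.

(** Open upper rays generate the Borel sets of the extended reals, and their preimages under [f] are
    open. *)
Lemma lower_semicontinuous_borel (R : realType) (n s : nat)
    (f : 'cV[R]_n * 'cV[R]_s -> \bar R) :
  lower_semicontinuous f -> borel_measurable f.
Proof.
move=> /lower_semicontinuousP f_open.
apply: (measurability _ (ErealGenOInfty.measurableE R)) => _ [_ [a ->]] <-.
rewrite setTI; apply: sub_sigma_algebra.
by rewrite preimage_itvoy; exact: f_open.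
Qed.

(** * Properties of the optimal value along [q] and [h] *)

Theorem proposition3 (R : realType) (n s m1 m2 k : nat)
    (q : 'cV[R]_n * 'cV[R]_s -> 'cV[R]_(m1 + m2))
    (h : 'cV[R]_n * 'cV[R]_s -> 'cV[R]_k)
    (A : 'M[R]_(k, m1 + m2)) (D : 'M[R]_(m1 + m2)) (gq gh : R)
    (A_rat : rational_mx A) (D_rat : rational_mx D)
    (D_sym : D^T = D) (D_posdef : posdef D)
    (feas : forall t : 'cV[R]_k, feasible A t !=set0)
    (q_cont : continuous q) (h_cont : continuous h)
    (q_lim : limited_by (fun p => enorm (q p)) gq)
    (h_lim : limited_by (fun p => enorm (h p)) gh) :
  let f : 'cV[R]_n * 'cV[R]_s -> \bar R :=
    fun p => miqp_value A D (q p) (h p) in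
  [/\ forall p, f p \is a fin_num,
      lower_semicontinuous f,
      limited_by (fun p => fine (f p)) (Num.max (2 * gq) (2 * gh)),
      borel_measurable f /\ (exists g : R, limited_by (fun p => fine (f p)) g) &
      (forall p p', feasible_integral_parts A (h p) =
                    feasible_integral_parts A (h p')) ->
      continuous (fun p => fine (f p) : R)].
Proof.
move=> f; have [C C0 fC] := miqp_value_bound D_posdef feas.
have f_fin p : f p \is a fin_num by have [] := fC (q p) (h p).
have f_lsc : lower_semicontinuous f.
  move=> p a ap; exists [set p' | (a%:E < f p')%E] => //.
  have qh : (q p', h p') @[p' --> p] --> (q p, h p).
    exact: cvg_pair (q_cont p) (h_cont p).
  exact: qh (miqp_value_lsc D_posdef feas ap).
have f_lim : limited_by (fun p => fine (f p)) (Num.max (2 * gq) (2 * gh)).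
  apply: (limited_by_bound C0 _ _ _ q_lim h_lim) => p; try exact: enorm_ge0.
  have [_ /le_trans->//] := fC (q p) (h p).
  (* The value bound uses the sup norm, which the Euclidean norm dominates. *)
  by rewrite ler_wpM2l// lerD2r lerD// ler_sqr ?nnegrE ?enorm_ge0 ?norm_le_enorm.
split=> //.
  split; first exact: lower_semicontinuous_borel.
  by exists (Num.max (2 * gq) (2 * gh)).
move=> parts p; apply/cvgrPdist_lt => e e0.
(* Continuity splits into a lower estimate from [f_lsc] and an upper one from the constancy of the
   integral parts. *)
have lo : \forall p' \near p, ((fine (f p) - e)%:E < f p')%E.
  have [|V pV Vf] := f_lsc p (fine (f p) - e).
    by rewrite -[ltRHS]fineK// lte_fin ltrBlDr ltrDl.
  by apply: filterS pV => p' /Vf.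
have up : \forall p' \near p, (f p' < (fine (f p) + e)%:E)%E.
  apply: (miqp_value_usc (q_cont p) (h_cont p)) => [p'|].
    by rewrite (parts p p').
  by rewrite -/(f p) -[ltLHS]fineK// lte_fin ltrDl.
apply: filterS2 lo up => p'; rewrite -(fineK (f_fin p')) !lte_fin => lo up.
by rewrite distrC ltr_distl lo.
Qed.
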